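(* Let $\mathcal G$ be a weighted directed graph on $n$ agents with Laplacian matrix $L=(L_{ij})$, and let $h>0$. Consider the multi-agent system with input saturation $$\dot x_i(t)=\mathrm{sat}_h(u_i(t)),\quad i=1,\dots,n,\ t\ge 0,$$ with states $x_i(t)\in\mathbb R^p$, under the distributed protocol $$u_i(t)=-\sum_{j=1}^n L_{ij}x_j(t).$$ Suppose that $\mathcal G$ is strongly connected. Then global consensus is achieved, i.e., for every initial condition $(x_1(0),\dots,x_n(0))\in(\mathbb R^p)^n$, $\lim_{t\to\infty}(x_i(t)-x_j(t))=0$ for all $i,j\in\{1,\dots,n\}$.
   Context: Weighted digraph: $\mathcal G=(\mathcal V,\mathcal E,\mathcal A)$ with agents $\mathcal V=\{v_1,\dots,v_n\}$, links $\mathcal E\subseteq\mathcal V\times\mathcal V$, and weighted adjacency matrix $\mathcal A=(a_{ij})$ with $a_{ij}\ge 0$ and $a_{ii}=0$. One has $(v_i,v_j)\in\mathcal E\iff a_{ij}>0$, and this means there is a directed link from $v_j$ to $v_i$ (agent $v_j$ can send information to $v_i$). Laplacian: $L=D-\mathcal A$ with $D=\mathrm{diag}(\sum_j a_{1j},\dots,\sum_j a_{nj})$; that is, $L_{ij}=-a_{ij}$ for $i\ne j$ and $L_{ii}=\sum_{j}a_{ij}$. Strongly connected: for any two distinct agents $v_i,v_j$ there is a directed path from $v_i$ to $v_j$ (a sequence of distinct agents beginning with $v_i$ and ending with $v_j$ with a directed link from each agent to the next). Saturation function: for a constant $h>0$ and scalar $s$, $\mathrm{sat}_h(s)=h$ if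 $s\ge h$, $\mathrm{sat}_h(s)=s$ if $|s|<h$, $\mathrm{sat}_h(s)=-h$ if $s\le -h$; for vectors it is applied componentwise. *)

(* Defs.v *)
From mathcomp Require Import all_boot all_order all_algebra.
From mathcomp Require Import all_classical all_reals all_analysis.

Set Implicit Arguments.
Unset Strict Implicit.
Unset Printing Implicit Defensive.

Import Order.TTheory GRing.Theory Num.Theory.
Import numFieldNormedType.Exports.

Local Open Scope classical_set_scope.
Local Open Scope ring_scope.

Record wdigraph (R : realType) (n : nat) := WDigraph {
  adj : 'M[R]_n;
  adj_ge0 : forall i j, 0 <= adj i j;
  adj_diag : forall i, adj i i = 0
}.

(* The weight in row i and column j belongs to the link from agent j to
   agent i: a positive entry means that j sends information to i. *)
Definition dlink (R : realType) (n : nat) (G : wdigraph R n) : rel 'I_n :=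
  fun j i => 0 < adj G i j.

Definition strongly_connected (R : realType) (n : nat) (G : wdigraph R n) :=
  forall i j : 'I_n, i != j ->
  exists s : seq 'I_n, [/\ path (dlink G) i s, last i s = j & uniq (i :: s)].

Definition laplacian (R : realType) (n : nat) (G : wdigraph R n) : 'M[R]_n :=
  diag_mx (\row_i \sum_j adj G i j) - adj G.

Definition sat (R : realType) (h s : R) : R :=
  if h <= s then h else if `|s| < h then s else - h.

Definition protocol (R : realType) (n p : nat) (L : 'M[R]_n)
    (x : 'I_n -> R -> 'rV[R]_p) (i : 'I_n) (t : R) : 'rV[R]_p :=
  - \sum_j L i j *: x j t.

(* Trajectories are functions on the whole line, but only their values on
   [0, +oo[ matter: the equation is imposed with the two-sided derivative
   for t > 0 and with the right derivative at t = 0. *)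
Definition saturated_solution (R : realType) (n p : nat) (h : R)
    (u x : 'I_n -> R -> 'rV[R]_p) :=
  forall i : 'I_n,
    (forall t : R, 0 < t -> is_derive t 1 (x i) (map_mx (sat h) (u i t))) /\
    (e^-1 *: (x i e - x i 0) @[e --> 0^'+] --> map_mx (sat h) (u i 0)).

Definition global_consensus (R : realType) (n p : nat) (h : R)
    (L : 'M[R]_n) :=
  forall (x0 : 'I_n -> 'rV[R]_p) (x : 'I_n -> R -> 'rV[R]_p),
    (forall i, x i 0 = x0 i) ->
    saturated_solution h (protocol L x) x ->
    forall i j : 'I_n, x i t - x j t @[t --> +oo] --> (0 : 'rV[R]_p).

(* Main.v *)
Require Import Defs.
From mathcomp Require Import all_boot all_order all_algebra.
From mathcomp Require Import all_classical all_reals all_analysis.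
From mathcomp Require Import ring lra.

(** The coordinates of the states do not interact: since [sat] acts entrywise
    and the i-th entry of [- L x] is [\sum_j a_ij (x_j - x_i)], each coordinate
    is a scalar flow [y_i' = sat (\sum_j a_ij (y_j - y_i))].  For such a flow
    one shows that the spread [max y - min y] tends to 0.

    The saturated flow keeps the order structure of the linear one.  An agent
    that currently holds the minimum has a nonnegative velocity, so lower
    bounds are preserved ([lower_bound_invariant]); as [sat] is odd, [- y] is
    again a flow and upper bounds are preserved too.  Hence the spread never
    increases, and it suffices to make it small once.

    Let [m] be a common lower bound.  As [sat] is nondecreasing and
    1-Lipschitz, [z_j := y_j - m >= 0] satisfies, whenever
    [z_i >= b] on a time interval,
      [z_j' >= sat (a_ji b) - (\sum_k a_jk) z_j],
    a linear inequality, which Gronwall integrates ([lower_growth]).  So an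
    agent that is above [m] stays above [m] by a definite amount
    ([persistence]) and lifts the agents that listen to it
    ([influences_link]).  These amounts depend only on the initial excess and
    the elapsed time, so the effect composes along paths: under strong
    connectivity an excess [v] of one agent over [m] raises all agents, within
    one unit of time, to [m + d] with a fixed [d > 0] ([lower_bound_jump]).

    If the spread exceeded [v > 0] at all positive times, the minimum would
    grow by [d] in each unit of time, whereas it stays below the maximum
    at time 1 ([spread_eventually_small]). *)

Set Implicit Arguments.
Unset Strict Implicit.
Unset Printing Implicit Defensive.
Import Order.TTheory GRing.Theory Num.Theory.
Import numFieldNormedType.Exports.
Local Open Scope classical_set_scope.
Local Open Scope ring_scope.

(** * The saturation function *)

Lemma sat0 (R : realType) (h : R) : 0 < h -> sat h 0 = 0.
Proof. by move=> h0; rewrite /sat normr0 h0 leNgt h0. Qed.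

Lemma sat_gt0 (R : realType) (h s : R) : 0 < h -> 0 < s -> 0 < sat h s.
Proof.
move=> h0 s0; rewrite /sat; case: (lerP h s) => // sh.
by rewrite gtr0_norm// sh.
Qed.

Lemma satN (R : realType) (h s : R) : 0 < h -> sat h (- s) = - sat h s.
Proof.
move=> h0; rewrite /sat normrN.
by case: (lerP h (- s)); case: (lerP h s); case: (ltrP `|s| h);
  case: (ger0P s); lra.
Qed.

(** Monotonicity and the Lipschitz constant 1 in one inequality: it moves a
    nonnegative linear term out of the saturation. *)
Lemma sat_lower (R : realType) (h w r s : R) :
  0 < h -> 0 <= r -> w - r <= s -> sat h w - r <= sat h s.
Proof.
move=> h0 r0 wrs; rewrite /sat.
by case: (lerP h w); case: (lerP h s); case: (ltrP `|s| h);
  case: (ltrP `|w| h); case: (ger0P s); case: (ger0P w); lra.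
Qed.

(** * One-variable calculus *)

(** The minimum may sit at the right end of the interval, so only the left
    difference quotients, all nonpositive, are available. *)
Lemma is_derive_left_min_le0 (R : realType) (f : R -> R) (a c d : R) :
  is_derive c 1 f d -> a < c -> (forall t, t \in `[a, c] -> f c <= f t) ->
  d <= 0.
Proof.
move=> [fc <-] ac cmin.
rewrite ['D_1 f c]cvg_at_leftE //.
apply: limr_le.
  rewrite -(cvg_at_leftE (fun h => h^-1 *: ((f \o shift c) _ - f c))) //.
  apply: cvg_trans fc; apply: cvg_app.
  move=> A [e egt0 Ae]; exists e => // x xe xgt0; apply: Ae => //.
  exact/ltr0_neq0.
near=> h; apply: mulr_le0_ge0.
  by rewrite invr_le0; apply: ltW; near: h; exists 1 => /=.
rewrite subr_ge0 [_%:A]mulr1; apply: cmin => /=.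
have hn : h < 0 by near: h; exact: nbhs_left_lt.
have hc : 0 - h < c - a by near: h; apply: nbhs_left_ltBl; rewrite subr_gt0.
by rewrite in_itv /=; apply/andP; split; lra.
Unshelve. all: by end_near. Qed.

(** [expR (K (t - a)) g t] has derivative at least [s], so the mean value
    theorem applies to it. *)
Lemma gronwall_lower (R : realType) (g dg : R -> R) (K s a b : R) :
  0 <= K -> 0 <= s -> a <= b ->
  (forall t, t \in `[a, b] -> is_derive t 1 g (dg t)) ->
  (forall t, t \in `[a, b] -> s <= dg t + K * g t) ->
  expR (- (K * (b - a))) * (g a + s * (b - a)) <= g b.
Proof.
move=> K0 s0 ab gdg dgs.
pose f := (fun t => expR (K * (t - a)) * g t) : R -> R.
have fdf t : t \in `[a, b] ->
    is_derive t 1 f (expR (K * (t - a)) * (dg t + K * g t)).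
  move=> tab; have gt := gdg t tab.
  have e1 : is_derive t 1 (fun t : R => K * (t - a)) K.
    by apply: is_derive_eq; rewrite subr0; exact: mulr1.
  have e2 := @is_derive1_comp _ expR (fun t => K * (t - a)) _ _ _
    (is_derive_expR _) e1.
  apply: is_derive_eq (is_deriveM e2 gt) _.
  rewrite -[LHS]/(expR (K * (t - a)) * dg t + g t * (expR (K * (t - a)) * K)).
  ring.
have [|c cab] := MVT_segment ab (fun t tab => fdf t (subset_itv_oo_cc tab)).
  by apply: derivable_within_continuous => t /fdf[].
rewrite /f subrr mulr0 expR0 mul1r => fE.
have : s * (b - a) <= expR (K * (b - a)) * g b - g a.
  rewrite fE; apply: ler_wpM2r; first by rewrite subr_ge0.
  apply: le_trans (dgs c cab) _; rewrite ler_peMl //.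
    exact: le_trans (dgs c cab).
  rewrite -expR0 ler_expR; move: cab; rewrite in_itv /= => /andP[ac _].
  by rewrite mulr_ge0 ?subr_ge0.
by rewrite expRN ler_pdivrMl ?expR_gt0//; lra.
Qed.

(** * Order properties of the scalar saturated flow *)

Definition degree (R : realType) (n : nat) (G : wdigraph R n) (i : 'I_n) : R :=
  \sum_j adj G i j.

Definition drift (R : realType) (n : nat) (G : wdigraph R n) (y : 'I_n -> R)
    (i : 'I_n) : R := \sum_j adj G i j * (y j - y i).

(** Restricting to [0 < t] loses nothing for limits at infinity and avoids the
    one-sided derivative at the origin. *)
Definition saturated_flow (R : realType) (n : nat) (h : R) (G : wdigraph R n)
    (y : 'I_n -> R -> R) :=
  forall (i : 'I_n) (t : R), 0 < t ->
    is_derive t 1 (y i) (sat h (drift G (y^~ t) i)).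

Section Flow.
Variables (R : realType) (n : nat) (h : R) (G : wdigraph R n).
Hypothesis h0 : 0 < h.

Lemma saturated_flowN (y : 'I_n -> R -> R) :
  saturated_flow h G y -> saturated_flow h G (fun i t => - y i t).
Proof.
move=> yG i t t0; have yd := yG i t t0.
apply: is_derive_eq (is_deriveN yd) _.
rewrite -satN //; congr sat; rewrite /drift -sumrN.
by apply: eq_bigr => j _; ring.
Qed.

(** Of the agents heard by [j], only [i] is kept; the others contribute
    nonnegatively because [m] bounds them from below. *)
Lemma drift_lower (y : 'I_n -> R) (m : R) (i j : 'I_n) :
  (forall k, m <= y k) ->
  adj G j i * (y i - m) - degree G j * (y j - m) <= drift G y j.
Proof.
move=> ym.
have -> : drift G y j = \sum_k adj G j k * (y k - m) - degree G j * (y j - m).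
  rewrite /drift /degree mulr_suml -sumrB; apply: eq_bigr => k _; ring.
rewrite lerD2r (bigD1 i) //= lerDl.
by apply: sumr_ge0 => k _; rewrite mulr_ge0 ?adj_ge0 // subr_ge0.
Qed.

Lemma degree_ge0 (i : 'I_n) : 0 <= degree G i.
Proof. by apply: sumr_ge0 => j _; exact: adj_ge0. Qed.

(** A minimum principle.  Minimize [y k t + c (t - t0)] over all agents and
    over the time interval: at a minimum later than [t0] the agent [k] is the
    lowest one, so its drift is nonnegative and the derivative is at least
    [c > 0], while a left minimum forces it to be nonpositive.  The tilt [c] is
    what makes this a contradiction, and it can be taken arbitrarily small. *)
Lemma lower_bound_invariant (y : 'I_n -> R -> R) (m t0 t1 : R) :
  saturated_flow h G y -> 0 < t0 -> t0 <= t1 ->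
  (forall k, m <= y k t0) -> forall i, m <= y i t1.
Proof.
move=> yG t00 t01 ym i.
apply/ler_addgt0Pr => e e0.
(* The denominator is shifted by 1 to allow [t1 = t0]. *)
pose c := e / (t1 - t0 + 1).
have c0 : 0 < c by rewrite divr_gt0//; lra.
have ce : c * (t1 - t0) <= e.
  rewrite /c mulrAC ler_pdivrMr; last by lra.
  by rewrite ler_pM2l //; lra.
pose f k (t : R) : R := y k t + c * (t - t0).
have fd k t : t \in `[t0, t1] ->
    is_derive t 1 (f k) (sat h (drift G (y^~ t) k) + c).
  rewrite in_itv /= => /andP[tt0 _].
  have yd := yG k t (lt_le_trans t00 tt0).
  have ld : is_derive t 1 (fun t : R => c * (t - t0)) c.
    by apply: is_derive_eq; rewrite subr0; exact: mulr1.
  exact: is_deriveD yd ld.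
have fmin k : exists s : R, s \in `[t0, t1] /\
    forall t, t \in `[t0, t1] -> f k s <= f k t.
  have [|s s01 smin] := @EVT_min R (f k) t0 t1 t01; last by exists s.
  by apply: derivable_within_continuous => t /(fd k)[].
have [s sP] := choice fmin.
have [k _ kmin] := @arg_minP _ R _ i predT (fun k => f k (s k)) isT.
have glob l t : t \in `[t0, t1] -> f k (s k) <= f l t.
  by move=> t01t; apply: le_trans (kmin l isT) _; apply: (sP l).2.
have fm l : f l t0 = y l t0 by rewrite /f subrr mulr0 addr0.
suff mk : m <= f k (s k).
  apply: le_trans mk (le_trans (glob i t1 _) _).
    by rewrite in_itv /= lexx t01.
  by rewrite lerD2l.
have sk01 := (sP k).1.
have := sk01; rewrite in_itv /= le_eqVlt => /andP[/orP[/eqP <-|t0s] st1].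
  by rewrite fm.
have sub t : t \in `[t0, s k] -> t \in `[t0, t1].
  by rewrite !in_itv /= => /andP[-> ts]; exact: le_trans ts st1.
have := is_derive_left_min_le0 (fd k _ sk01) t0s
  (fun t tI => glob k t (sub t tI)).
have yk l : y k (s k) <= y l (s k) by have := glob l _ sk01; rewrite lerD2r.
have drift0 : 0 - 0 <= drift G (y^~ (s k)) k.
  rewrite subr0; apply: sumr_ge0 => l _.
  by rewrite mulr_ge0 ?adj_ge0 // subr_ge0.
have := sat_lower h0 (lexx 0) drift0; rewrite sat0 //; lra.
Qed.

(** The differential inequality of the excess [y j - m], integrated by
    [gronwall_lower]. *)
Lemma lower_growth (y : 'I_n -> R -> R) (m b t0 t1 : R) (i j : 'I_n) :
  saturated_flow h G y -> 0 < t0 -> t0 <= t1 ->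
  (forall k, m <= y k t0) -> 0 <= b ->
  (forall t, t \in `[t0, t1] -> m + b <= y i t) ->
  m + expR (- (degree G j * (t1 - t0))) *
      ((y j t0 - m) + sat h (adj G j i * b) * (t1 - t0)) <= y j t1.
Proof.
move=> yG t00 t01 ym b0 yb.
have w0 : 0 <= adj G j i * b by rewrite mulr_ge0 ?adj_ge0.
have s0 : 0 <= sat h (adj G j i * b).
  by move: w0; rewrite le_eqVlt => /orP[/eqP <-|/(sat_gt0 h0)/ltW//];
    rewrite sat0.
rewrite addrC -lerBrDr.
apply: (@gronwall_lower _ (fun t => y j t - m)
  (fun t => sat h (drift G (y^~ t) j))) => // [|t|t].
- exact: degree_ge0.
- rewrite in_itv /= => /andP[tt0 _].
  have yd := yG j t (lt_le_trans t00 tt0).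
  by apply: is_derive_eq (is_deriveB yd (is_derive_cst m t 1)) _; rewrite subr0.
- move=> tI; have := tI; rewrite in_itv /= => /andP[tt0 _].
  have yt := lower_bound_invariant yG t00 tt0 ym.
  rewrite -lerBlDr; apply: sat_lower => //.
    by rewrite mulr_ge0 ?degree_ge0 // subr_ge0.
  apply: le_trans (drift_lower i j yt); rewrite lerD2r.
  by rewrite ler_wpM2l ?adj_ge0 //; have := yb t tI; lra.
Qed.

(** The case [b = 0] of [lower_growth], where nothing is received: the excess
    of an agent decays at most exponentially. *)
Lemma persistence (y : 'I_n -> R -> R) (m b t0 t1 : R) (i : 'I_n) :
  saturated_flow h G y -> 0 < t0 -> t0 <= t1 ->
  (forall k, m <= y k t0) -> m + b <= y i t0 ->
  m + expR (- (degree G i * (t1 - t0))) * b <= y i t1.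
Proof.
move=> yG t00 t01 ym yb.
have H t : t \in `[t0, t1] -> m + 0 <= y i t.
  rewrite addr0 in_itv /= => /andP[tt _]; exact: (lower_bound_invariant yG t00 tt ym).
have := lower_growth i yG t00 t01 ym (lexx 0) H.
rewrite mulr0 sat0 // mul0r addr0; apply: le_trans.
rewrite lerD2l ler_pM2l ?expR_gt0 //; lra.
Qed.

(** * Propagation along the graph *)

(** The gain [d] is chosen before the flow, the bound [m] and the time [t]:
    this uniformity lets influences compose and makes the gain the same at
    every later time.  Allowing every delay [tau] makes the relation
    transitive, by splitting the delay in halves. *)
Definition influences (i j : 'I_n) :=
  forall b tau : R, 0 < b -> 0 < tau -> exists2 d : R, 0 < d &
    forall y m t, saturated_flow h G y -> 0 < t -> (forall k, m <= y k t) ->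
      m + b <= y i t -> m + d <= y j (t + tau).

Lemma influences_refl i : influences i i.
Proof.
move=> b tau b0 tau0; exists (expR (- (degree G i * tau)) * b).
  by rewrite mulr_gt0 ?expR_gt0.
move=> y m t yG t0 ym yb.
have /(_ (t + tau)) := persistence yG t0 _ ym yb.
by rewrite lerDl (ltW tau0) => /(_ isT); rewrite addrAC subrr add0r.
Qed.

Lemma influences_trans i j k :
  influences i j -> influences j k -> influences i k.
Proof.
move=> ij jk b tau b0 tau0; have tau20 : 0 < tau / 2 by rewrite divr_gt0.
have [d d0 dP] := ij b _ b0 tau20; have [e e0 eP] := jk d _ d0 tau20.
exists e => // y m t yG t0 ym yb.
rewrite (splitr tau) addrA; apply: eP => //; [by lra| |exact: dP].
by apply: (lower_bound_invariant yG t0 _ ym); lra.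
Qed.

(** By [persistence] the source keeps an excess [c] during the whole delay, so
    the receiver is pushed at rate at least [sat (a_ji c) > 0]. *)
Lemma influences_link i j : dlink G i j -> influences i j.
Proof.
move=> aij b tau b0 tau0.
pose c := expR (- (degree G i * tau)) * b.
have c0 : 0 < c by rewrite mulr_gt0 ?expR_gt0.
exists (expR (- (degree G j * tau)) * (sat h (adj G j i * c) * tau)).
  apply: mulr_gt0; first exact: expR_gt0.
  by apply: mulr_gt0 => //; apply: sat_gt0 => //; exact: mulr_gt0.
move=> y m t yG t0 ym yb.
have tt : t <= t + tau by lra.
have H s : s \in `[t, t + tau] -> m + c <= y i s.
  rewrite in_itv /= => /andP[ts st].
  apply: le_trans (persistence yG t0 ts ym yb).
  rewrite lerD2l ler_pM2r // ler_expR lerN2.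
  by rewrite ler_wpM2l ?degree_ge0 //; lra.
apply: le_trans (lower_growth j yG t0 tt ym (ltW c0) H).
rewrite lerD2l addrAC subrr add0r ler_pM2l ?expR_gt0 //.
by rewrite lerDr subr_ge0.
Qed.

Lemma influences_strongly_connected : strongly_connected G ->
  forall i j, influences i j.
Proof.
move=> sc i j; have [->|/sc[s [+ <- _]]] := eqVneq i j.
  exact: influences_refl.
elim: s i => [|k s IHs] i /=; first by move=> _; exact: influences_refl.
move=> /andP[ik ks]; exact: influences_trans (influences_link ik) (IHs k ks).
Qed.

(** The agent realizing the spread changes with time; finiteness of the set of
    pairs provides one gain [d] that works for all of them. *)
Lemma lower_bound_jump (v : R) : strongly_connected G -> 0 < v ->
  exists2 d, 0 < d &
    forall y m t, saturated_flow h G y -> 0 < t -> (forall k, m <= y k t) ->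
      (exists i j, v < y i t - y j t) -> forall k, m + d <= y k (t + 1).
Proof.
move=> sc v0.
pose P (d : R) (ik : 'I_n * 'I_n) := forall y m t,
  saturated_flow h G y -> 0 < t -> (forall k, m <= y k t) ->
  m + v <= y ik.1 t -> m + d <= y ik.2 (t + 1).
have nearP : \forall d \near 0^'+, forall ik, P d ik.
  apply: filter_forall => -[i k].
  have [e e0 eP] := influences_strongly_connected sc i k v0 ltr01.
  near=> d => y m t yG t0 ym yv.
  apply: le_trans (eP y m t yG t0 ym yv); rewrite lerD2l.
  by near: d; exact: nbhs_right_le.
have [d [d0 dP]] := filter_ex (filterI (nbhs_right_gt 0) nearP).
exists d => // y m t yG t0 ym [i [j vij]] k.
by apply: (dP (i, k)) => //=; have := ym j; lra.
Unshelve. all: by end_near. Qed.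

(** * Decay of the spread *)

Lemma spread_le_invariant (y : 'I_n -> R -> R) (v t0 t1 : R) :
  saturated_flow h G y -> 0 < t0 -> t0 <= t1 ->
  (forall i j, y i t0 - y j t0 <= v) -> forall i j, y i t1 - y j t1 <= v.
Proof.
move=> yG t00 t01 yv i j.
have [k _ kmin] := @arg_minP _ R _ i predT (fun k => y k t0) isT.
have lo := lower_bound_invariant yG t00 t01 (fun l => kmin l isT) j.
have hi := lower_bound_invariant (saturated_flowN yG) t00 t01
  (_ : forall l, - (y k t0 + v) <= - y l t0) i.
have {}hi : - (y k t0 + v) <= - y i t1.
  by apply: hi => l; have := yv l k; lra.
lra.
Qed.

(** Otherwise [lower_bound_jump] applies at the times 1, 2, 3, and so on, with
    the same gain, and the minimum outgrows the maximum at time 1. *)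
Lemma spread_eventually_small (y : 'I_n -> R -> R) (v : R) :
  strongly_connected G -> saturated_flow h G y -> 0 < v ->
  exists2 t, 0 < t & forall i j, y i t - y j t <= v.
Proof.
move=> sc yG v0; apply: contrapT => nex.
have big (t : R) : 0 < t -> exists i j, v < y i t - y j t.
  move=> t0; apply: contrapT => nij; apply: nex; exists t => // i j.
  by rewrite leNgt; apply/negP => vij; apply: nij; exists i, j.
have [d d0 dP] := lower_bound_jump sc v0.
have [i0 _] := big 1 ltr01.
have [lo _ loP] := @arg_minP _ R _ i0 predT (fun k => y k 1) isT.
have [hi _ hiP] := @arg_minP _ R _ i0 predT (fun k => - y k 1) isT.
have grow (q : nat) k : y lo 1 + d * q%:R <= y k (1 + q%:R).
  elim: q k => [|q IHq] k; first by rewrite mulr0 !addr0; exact: loP.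
  have t0 : 0 < 1 + q%:R :> R by rewrite ltr_pwDl.
  have := dP _ _ _ yG t0 IHq (big _ t0) k.
  by rewrite -(natr1 q) mulrDr mulr1 !addrA.
pose q := (Num.trunc ((y hi 1 - y lo 1) / d)).+1.
have : y hi 1 - y lo 1 < d * q%:R.
  by rewrite mulrC -ltr_pdivrMr //; exact: truncnS_gt.
have q1 : 1 <= 1 + q%:R :> R by rewrite lerDl.
have := lower_bound_invariant (saturated_flowN yG) ltr01 q1
  (fun l => hiP l isT) i0.
have := grow q i0.
lra.
Qed.

End Flow.

(** * Reduction to coordinates *)

Lemma component_flow (R : realType) (n p : nat) (h : R) (G : wdigraph R n)
    (x : 'I_n -> R -> 'rV[R]_p) (k : 'I_p) :
  saturated_solution h (protocol (laplacian G) x) x ->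
  saturated_flow h G (fun i t => x i t ord0 k).
Proof.
move=> sol i t t0; have [/(_ t t0) [xd xE] _] := sol i.
have xdk := (derivable_mxP _ _ _).1 xd ord0 k.
apply: DeriveDef => //.
move: xE; rewrite derive_mx // => /(congr1 (fun v : 'rV[R]_p => v ord0 k)).
rewrite !mxE => ->; congr sat.
rewrite /drift summxE.
under eq_bigr do rewrite !mxE.
transitivity (degree G i * - x i t ord0 k + \sum_j adj G i j * x j t ord0 k).
  rewrite -sumrN (bigD1 i) //= [in RHS](bigD1 i) //= addrA; congr (_ + _).
    by rewrite eqxx mulr1n /degree; ring.
  apply: eq_bigr => j /negbTE ji; rewrite eq_sym ji mulr0n; ring.
rewrite /degree mulr_suml -big_split /=; apply: eq_bigr => j _; ring.
Qed.

Theorem theorem1 (R : realType) (n p : nat) (h : R) (G : wdigraph R n) :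
  0 < h -> strongly_connected G -> global_consensus p h (laplacian G).
Proof.
move=> h0 sc x0 x _ sol i j.
apply/cvgr0Pnorm_le => e e0.
have comp (k : 'I_p) : \forall t \near +oo,
    forall a b, x a t ord0 k - x b t ord0 k <= e.
  have yG := component_flow k sol.
  have [t t0 tP] := spread_eventually_small h0 sc yG e0.
  near=> s; apply: (spread_le_invariant h0 yG t0 _ tP).
  by near: s; apply: nbhs_pinfty_ge; exact: num_real.
apply: filterS (filter_forall _ comp) => t tP.
rewrite /Num.Def.normr /= mx_normrE.
apply: bigmax_le => [|[a k] _]; first exact: ltW.
rewrite /= !mxE ord1 ler_norml.
by have := tP k i j; have := tP k j i; lra.
Unshelve. all: by end_near. Qed.
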